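(* Let $m \ge n \ge 2$ and $0 \le k \le nm$ be integers. For each prime power $q$, denote by $\mathcal{F}$ the family of $\mathbb{F}_q$-linear subspaces of $\mathbb{F}_q^{n\times m}$ of dimension $k$. Define $\rho_k:=n-\lfloor k/m\rfloor$ and let $\mathcal{F}':=\{\mathcal{C}\in\mathcal{F} \mid \rho^{\mathrm{rk}}(\mathcal{C})=\rho_k\}$. Then $$\lim_{q\to\infty}\frac{|\mathcal{F}'|}{|\mathcal{F}|}=1,\quad\text{provided that } k<(m-n+\lfloor k/m\rfloor+1)(\lfloor k/m\rfloor+1),$$ where the limit is over prime powers $q$, with $n,m,k$ fixed.
   Context: The rank metric covering radius of a code $\mathcal{C}\subseteq\mathbb{F}_q^{n\times m}$, denoted $\rho^{\mathrm{rk}}(\mathcal{C})$, is the smallest $r\in\mathbb{N}$ such that for every $x\in\mathbb{F}_q^{n\times m}$ there exists $y\in\mathcal{C}$ with $\mathrm{rk}(x-y)\le r$. *)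

(* Defs.v *)
From HB Require Import structures.
From mathcomp Require Import all_boot all_order all_algebra all_field.
From mathcomp Require Import all_classical all_reals all_analysis.
Set Implicit Arguments.
Unset Strict Implicit.
Unset Printing Implicit Defensive.
Import Order.TTheory GRing.Theory Num.Theory.
Import numFieldNormedType.Exports.
Local Open Scope ring_scope.

(* A subspace of a finite-dimensional space over a finite field is stored as
   its canonical generating matrix, so there are finitely many of them. *)
Section FiniteVspace.
Import VectorInternalTheory.
Variables (K : finFieldType) (vT : vectType K).
HB.instance Definition _ := [Countable of {vspace vT} by <:].
HB.instance Definition _ := [Finite of {vspace vT} by <:].
End FiniteVspace.

Section RankMetric.
Variables (K : finFieldType) (n m : nat).
Implicit Types C : {vspace 'M[K]_(n, m)}.

Definition rk_covers C (r : nat) : bool :=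
  [forall x : 'M[K]_(n, m), [exists y in C, (\rank (x - y)%R <= r)%N]].

Fact rk_covers_exists C : exists r, rk_covers C r.
Proof.
exists n; apply/forallP => x; apply/existsP; exists 0.
by rewrite mem0v rank_leq_row.
Qed.

Definition rk_covering_radius C : nat := ex_minn (rk_covers_exists C).

Definition subspaces_of_dim (k : nat) : {set {vspace 'M[K]_(n, m)}} :=
  finset (fun C => \dim C == k).

Definition subspaces_of_dim_radius (k rho : nat) :
    {set {vspace 'M[K]_(n, m)}} :=
  finset (fun C => (C \in subspaces_of_dim k) &&
                   (rk_covering_radius C == rho)).

End RankMetric.

Definition prime_power (q : nat) : Prop :=
  exists p e : nat, [/\ prime p, (0 < e)%N & q = (p ^ e)%N].

(* [is_Fq_family F]: F q is a field with q elements, for every prime power q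
   (unique up to isomorphism); at other q the value of F is irrelevant. *)
Definition is_Fq_family (F : nat -> finFieldType) : Prop :=
  forall q : nat, prime_power q -> #|F q| = q.

Fact Fq_family_exists : exists F : nat -> finFieldType, is_Fq_family F.
Proof.
have GF q : {F : finFieldType | prime_power q -> #|F| = q}.
  apply: cid; have [[p [e [p_pr e_gt0 ->]]]|nq] := pselect (prime_power q).
    by have [F _ cF] := pPrimePowerField p_pr e_gt0; exists F.
  by exists 'F_2.
by exists (fun q => sval (GF q)) => q; exact: (svalP (GF q)).
Qed.

Definition prime_powers_oo : set_system nat :=
  within prime_power (nbhs \oo)%classic.

Fact prime_powers_oo_proper : ProperFilter prime_powers_oo.
Proof.
split; last exact: within_filter.
move=> [N _ hN]; have [p Np p_pr] := prime_above N.
by apply: (hN p); [exact: ltnW | exists p, 1%N; rewrite expn1].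
Qed.

(* Main.v *)
(** Put l = k / m.  Radius at least n - l holds for every C once q > 2^n:
    adding rows one at a time bounds the rank ball of radius r by
    2^n q^(r(m+n-r)), and the hypothesis on k says that balls of radius
    n - l - 1 around the points of C are then too small to cover.
    Radius at most n - l holds whenever C + U is the whole space, where U is
    the (n - l)m-dimensional space of matrices supported on n - l rows.
    Since GL acts transitively on nonzero vectors, the average of |C cap U| over
    all C is at most q^e + 1, with e = k + dim U - nm, while |C cap U| is at
    least q^e, and at least q^(e+1) if C + U is a proper subspace; by Markov's
    inequality the latter happens for at most 1/(q-1) of the C. *)

Require Import Defs.
From HB Require Import structures.
From mathcomp Require Import all_boot all_order all_algebra all_field.
From mathcomp Require Import all_classical all_reals all_analysis.
From mathcomp Require Import zify lra.
Import Order.TTheory GRing.Theory Num.Theory.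
Import numFieldNormedType.Exports.
Local Open Scope ring_scope.
Set Implicit Arguments.
Unset Strict Implicit.
Unset Printing Implicit Defensive.

(** * Transitivity of invertible maps on nonzero vectors *)

(** Rank one gives [u = a e1 P] and [v = b e1 Q] with [P], [Q] invertible and [a], [b] nonzero, so
    [(b / a) P^-1 Q] carries [u] to [v]. *)
Lemma row_vector_trans (K : fieldType) (N : nat) (u v : 'rV[K]_N) :
  u != 0 -> v != 0 -> exists2 A, A \in unitmx & u *m A = v.
Proof.
move=> u0 v0.
have Eu := mulmx_ebase u; have Ev := mulmx_ebase v.
rewrite rank_rV u0 [col_ebase _]mx11_scalar mul_scalar_mx -scalemxAl in Eu.
rewrite rank_rV v0 [col_ebase _]mx11_scalar mul_scalar_mx -scalemxAl in Ev.
set a := col_ebase u 0 0 in Eu; set b := col_ebase v 0 0 in Ev.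
have a0 : a != 0 by apply: contra_neq u0 => a0; rewrite -Eu a0 scale0r.
have b0 : b != 0 by apply: contra_neq v0 => b0; rewrite -Ev b0 scale0r.
exists ((b / a) *: (invmx (row_ebase u) *m row_ebase v)).
  rewrite unitmxZ ?unitfE ?mulf_neq0 ?invr_eq0 //.
  by rewrite unitmx_mul unitmx_inv !row_ebase_unit.
rewrite -[u in u *m _]Eu -scalemxAr -scalemxAl scalerA divfK //.
by rewrite mulmxA mulmxK ?row_ebase_unit.
Qed.

Lemma vspace_trans (K : fieldType) (vT : vectType K) (u v : vT) :
  u != 0 -> v != 0 -> exists2 f : 'End(vT), lker f == 0%VS & f u = v.
Proof.
move=> u0 v0; have [e eP] : exists e : (\dim {:vT}).-tuple vT, basis_of {:vT} e.
  by exists (vbasis {:vT}); exact: vbasisP.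
have nz (w : vT) : w != 0 -> passmx.rVof e w != 0.
  apply: contra_neq => w0; rewrite -(passmx.rVofK eP w) w0.
  by apply/eqP; rewrite passmx.vecof_eq0.
have [A Au Ae] := row_vector_trans (nz u u0) (nz v v0).
exists (passmx.hommx e e A); last first.
  by rewrite passmx.hommxE // Ae (passmx.rVofK eP).
apply/lker0P => x y; rewrite !passmx.hommxE // => /(can_inj (passmx.vecofK eP)).
by move/(can_inj (mulmxK Au))/(can_inj (passmx.rVofK eP)).
Qed.

(** * Double counting and Markov's inequality for subspaces *)

Section Counting.
Variables (K : finFieldType) (n m k : nat).
Local Notation V := 'M[K]_(n, m).
Local Notation q := #|K|.
Local Notation S := (subspaces_of_dim K n m k).

(** An automorphism sending [u] to [v] injects the first family into the second; exchanging the two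
    vectors gives equality. *)
Lemma card_subspaces_through (u v : V) : u != 0 -> v != 0 ->
  #|[set C in S | u \in C]| = #|[set C in S | v \in C]|.
Proof.
suff le (x y : V) : x != 0 -> y != 0 ->
    (#|[set C in S | x \in C]| <= #|[set C in S | y \in C]|)%N.
  by move=> u0 v0; apply/eqP; rewrite eqn_leq !le.
move=> x0 y0; have [f f0 fx] := vspace_trans x0 y0.
have inj : injective (fun C : {vspace V} => (f @: C)%VS).
  by move=> C D /eqP; rewrite eq_limg_ker0 // => /eqP.
rewrite -(card_imset _ inj); apply/subset_leq_card/fintype.subsetP => D.
case/imsetP => C; rewrite !inE => /andP[/eqP dC xC] ->.
rewrite limg_dim_eq ?dC ?eqxx -?fx ?memv_img //.
by rewrite (eqP f0) capv0.
Qed.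

Lemma card_vspace_nz (U : {vspace V}) :
  #|[set u : V in U | u != 0]|.+1 = (q ^ \dim U)%N.
Proof.
rewrite -card_vspace [in RHS](cardD1 (0 : V)) mem0v add1n; congr _.+1.
by apply: eq_card => u; rewrite !inE andbC.
Qed.

(** Double counting of the pairs [(C, x)] with [x] nonzero in [C :&: U]: the number of [C] through
    [x] is the same for all such [x]. *)
Lemma sum_card_subspaces_cap (U : {vspace V}) (u : V) : u != 0 ->
  (\sum_(C in S) #|[set x : V in (C :&: U)%VS | x != 0%R]|
    = #|[set x : V in U | x != 0%R]| * #|[set C in S | u \in C]|)%N.
Proof.
move=> u0.
transitivity (\sum_(C in S) \sum_(x in [set x : V in U | x != 0%R]) (x \in C : nat))%N.
  apply: eq_bigr => C _; rewrite -sum1_card -big_mkcondr /=.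
  by apply: eq_bigl => x; rewrite !inE memv_cap -andbA andbC.
rewrite exchange_big /= -sum_nat_const; apply: eq_bigr => x.
rewrite !inE => /andP[_ x0]; rewrite (card_subspaces_through u0 x0) //.
by rewrite -sum1_card -big_mkcondr /=; apply: eq_bigl => C; rewrite !inE.
Qed.

Lemma card_noncomplement (U : {vspace V}) : (n * m <= k + \dim U)%N ->
  (#|[set C in S | (C + U)%VS != fullv]| * (q - 1) <= #|S|)%N.
Proof.
move=> hU; set B := [set C in S | _].
have q1 : (1 < q)%N by exact: finNzRing_gt1.
have dV : \dim {:V} = (n * m)%N by rewrite dimvf dim_matrix.
(* In the zero space there is no nonzero vector to count with, but every [C + U] is full. *)
have [N0|Npos] := posnP (n * m)%N.
  rewrite [B](_ : _ = finset.set0) ?cards0 //; apply/finset.setP => C; rewrite !inE.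
  apply/negbTE; rewrite negb_and negbK; apply/orP; right.
  by rewrite eqEdim subvf dV N0.
have [u u0] : exists u : V, u != 0.
  exists (vpick {:V}); rewrite vpick0 -dimv_eq0 dV.
  by rewrite -lt0n.
(* The dimension of [C :&: U] when [C + U] is full; [hU] keeps the subtraction from truncating. *)
pose e := (k + \dim U - n * m)%N.
pose A := #|[set C in S | u \in C]|.
have nzS (C : {vspace V}) : C \in S ->
    #|[set x : V in C | x != 0]| = (q ^ k - 1)%N.
  by rewrite inE => /eqP <-; rewrite -card_vspace_nz subn1.
have nzU : #|[set x : V in U | x != 0]| = (q ^ \dim U - 1)%N.
  by rewrite -card_vspace_nz subn1.
have nzV : #|[set x : V in fullv | x != 0]| = (q ^ (n * m) - 1)%N.
  by rewrite -dV -card_vspace_nz subn1.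
(* Double counting with the full space in place of [U] ties [A] to [#|S|]. *)
have avgV : (#|S| * (q ^ k - 1) = (q ^ (n * m) - 1) * A)%N.
  rewrite -nzV -sum_card_subspaces_cap // -sum_nat_const.
  by apply: eq_bigr => C /nzS <-; rewrite capvf.
have avgU := sum_card_subspaces_cap U u0.
rewrite nzU -/A in avgU.
(* Each [C] contributes at least [q ^ e - 1]; a [C] in [B] meets [U] in dimension at least [e + 1],
   hence [q ^ e * (q - 1)] more. *)
have low : (#|S| * (q ^ e - 1) + #|B| * (q ^ e * (q - 1))
    <= (q ^ \dim U - 1) * A)%N.
  rewrite -avgU -!sum_nat_const [X in (_ + X <= _)%N]big_mkcond /=.
  rewrite [X in (_ + X <= _)%N](bigID (mem S)) /= [X in (_ + (_ + X) <= _)%N]big1; last first.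
    by move=> C; rewrite !inE => /negbTE ->.
  rewrite addn0 -big_split /=; apply: leq_sum => C CS.
  rewrite -ltnS card_vspace_nz !inE.
  have dC : \dim C = k by move: CS; rewrite inE => /eqP.
  have hd := dimv_sum_cap C U; rewrite dC in hd.
  have hs : (\dim (C + U) <= n * m)%N by rewrite -dV dimvS ?subvf.
  have qe : (0 < q ^ e)%N by rewrite expn_gt0 ltnW.
  have [CU|CU] := eqVneq (C + U)%VS fullv; rewrite ?andbF ?andbT.
    rewrite addn0 subn1 prednK // leq_exp2l //.
    by move: hd; rewrite /e CU dV; lia.
  have -> : \dim C == k by exact/eqP.
  have hs' : (\dim (C + U) < n * m)%N.
    rewrite ltn_neqAle hs andbT -dV; apply: contra CU => /eqP dCU.
    by rewrite eqEdim subvf dCU /=.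
  apply: (@leq_trans (q ^ e.+1)); last by rewrite leq_exp2l // /e; lia.
  rewrite expnS mulnBr muln1 [(q * _)%N]mulnC /=; have := leq_pmulr (q ^ e) (ltnW q1).
  by move: qe; move: (q ^ e)%N (q ^ e * q)%N => a b; lia.
(* For [k] above [n * m] there are no subspaces to count, so [B] is empty. *)
have kN : (k <= n * m)%N \/ #|B| = 0%N.
  have [->|[C]] := set_0Vmem B; first by right; rewrite cards0.
  by rewrite !inE => /andP[/eqP <- _]; left; rewrite -dV dimvS ?subvf.
case: kN => [kN|-> //].
have UN : (\dim U <= n * m)%N by rewrite -dV dimvS ?subvf.
have Nfac : (1 < q ^ (n * m))%N by rewrite -(exp1n (n * m)) ltn_exp2r.
have efac : (q ^ e * q ^ (n * m) = q ^ k * q ^ \dim U)%N.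
  by rewrite -!expnD; congr (_ ^ _)%N; rewrite /e; lia.
have eU : (q ^ e <= q ^ \dim U)%N by rewrite leq_exp2l // /e; lia.
have e1 : (0 < q ^ e)%N by rewrite expn_gt0 ltnW.
have k1 : (0 < q ^ k)%N by rewrite expn_gt0 ltnW.
have low' := leq_mul (leqnn (q ^ (n * m) - 1)) low.
have up : ((q ^ (n * m) - 1) * ((q ^ \dim U - 1) * A) =
           (q ^ \dim U - 1) * (#|S| * (q ^ k - 1)))%N by rewrite avgV; lia.
rewrite up in low'.
(* By [efac] this amounts to [q ^ e + 1 <= q ^ \dim U + q ^ k]. *)
have key : ((q ^ \dim U - 1) * (q ^ k - 1) <= (q ^ (n * m) - 1) * q ^ e)%N.
  move: efac; rewrite !mulnBl !mulnBr !mul1n muln1.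
  by rewrite [(q ^ (n * m) * _)%N]mulnC [(q ^ k * _)%N]mulnC => ->; lia.
have : ((q ^ (n * m) - 1) * (#|S| * (q ^ e - 1) + #|B| * (q ^ e * (q - 1)))
    <= (q ^ (n * m) - 1) * (q ^ e * #|S|))%N.
  apply: leq_trans low' _.
  by rewrite mulnCA mulnC mulnA; have := leq_mul key (leqnn #|S|); lia.
rewrite leq_pmul2l ?subn_gt0 // => fin.
have : (#|B| * (q - 1) * q ^ e <= #|S|)%N by nia.
by apply: leq_trans; exact: leq_pmulr.
Qed.
End Counting.

(** * Size of rank balls *)

Section Balls.
Variables (K : finFieldType) (m : nat).
Local Notation q := #|K|.

Definition rank_ball (n r : nat) : {set 'M[K]_(n, m)} :=
  [set A | (\rank A <= r)%N].

Lemma card_row_space (n : nat) (A : 'M[K]_(n, m)) :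
  (#|[set a : 'rV_m | (a <= A)%MS]| <= q ^ \rank A)%N.
Proof.
rewrite -[(\rank A)%N in X in (_ <= X)%N]mul1n -card_mx.
apply: leq_trans (leq_imset_card (fun x : 'rV_(\rank A) => x *m row_base A) _).
apply/subset_leq_card/fintype.subsetP => a; rewrite inE -(eq_row_base A) => /submxP[x ->].
by apply/imsetP; exists x.
Qed.

(** Split off the first row [a] from the rest [x]. If [x] has rank [r.+1], then [a] lies in its row
    space, of size [q ^ r.+1]; if [x] has rank at most [r], all [q ^ m] rows are counted. *)
Lemma card_rank_ball_recl (n r : nat) :
  (#|rank_ball n.+1 r.+1|
    <= #|rank_ball n r.+1| * q ^ r.+1 + #|rank_ball n r| * q ^ m)%N.
Proof.
pose D (x : 'M[K]_(n, m)) := [set a : 'rV[K]_m |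
  ((a <= x)%MS && (\rank x <= r.+1)%N) || (\rank x <= r)%N].
pose f (z : 'M[K]_(n, m) * 'rV[K]_m) : 'M[K]_(1 + n, m) := col_mx z.2 z.1.
have sub : rank_ball n.+1 r.+1 \subset
    [set f z | z in [set z | z.2 \in D z.1]].
  apply/fintype.subsetP => A; rewrite inE => rA; apply/imsetP.
  exists (@dsubmx _ 1 n _ A, @usubmx _ 1 n _ A); last by rewrite /f /= vsubmxK.
  rewrite !inE /=; set a := usubmx _; set x := dsubmx _.
  have rax : \rank (a + x)%MS = \rank A.
    by rewrite addsmxE vsubmxK.
  have ry : (\rank x <= \rank A)%N by rewrite -rax mxrankS ?addsmxSr.
  case ax : (a <= x)%MS; first by rewrite (leq_trans ry rA).
  (* Outside the row space of [x], adding [a] raises the rank strictly. *)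
  rewrite orFb -ltnS; apply: leq_trans rA; rewrite -rax ltn_neqAle.
  rewrite mxrankS ?addsmxSr // andbT; apply: contraFN ax => /eqP e.
  apply: submx_trans (addsmxSl a x) _.
  by rewrite -(mxrank_leqif_sup (addsmxSr a x)).2 e.
apply: leq_trans (subset_leq_card sub) _; apply: leq_trans (leq_imset_card _ _) _.
rewrite -sum1_card (eq_bigl (fun z : _ * _ => xpredT z.1 && (z.2 \in D z.1))); last first.
  by move=> z; rewrite inE.
rewrite -(pair_big_dep xpredT (fun x a => a \in D x) (fun _ _ => 1%N)) /=.
rewrite -[#|rank_ball n r.+1|]sum1_card -[#|rank_ball n r|]sum1_card !big_distrl /=.
rewrite [X in (_ <= X + _)%N]big_mkcond [X in (_ <= _ + X)%N]big_mkcond -big_split /=; apply: leq_sum => x _.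
rewrite sum1_card !inE !mul1n; have [xr|xr] := leqP (\rank x) r.
  apply: leq_trans (leq_addl _ _); apply: leq_trans (max_card _) _.
  by rewrite card_mx mul1n.
have [xr1|xr1] := leqP (\rank x) r.+1; last first.
  rewrite eq_card0 // => a; rewrite !inE.
  by rewrite [(_ <= r.+1)%N]leqNgt xr1 [(_ <= r)%N]leqNgt xr andbF.
rewrite addn0; apply: (@leq_trans (q ^ \rank x)); last first.
  by rewrite leq_exp2l // finNzRing_gt1.
apply: leq_trans (card_row_space x); apply/subset_leq_card/fintype.subsetP => a.
by rewrite !inE xr1 andbT [(_ <= r)%N]leqNgt xr orbF.
Qed.

(** Induction on [n]: each term of the recursion is at most [2 ^ n] times the target power of [q],
    and having two terms accounts for the doubling. *)
Lemma card_rank_ball (n r : nat) : (r <= n)%N ->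
  (#|rank_ball n r| <= 2 ^ n * q ^ (r * (m + n - r)))%N.
Proof.
have q0 : (0 < q)%N by rewrite ltnW // finNzRing_gt1.
elim: n r => [|n IH] [|r] rn //.
- by rewrite (leq_trans (max_card _)) // card_mx mul0n.
- rewrite mul0n muln1 (@leq_trans 1) ?expn_gt0 //.
  rewrite -[X in (_ <= X)%N](cards1 (0 : 'M[K]_(n.+1, m))).
  apply/subset_leq_card/fintype.subsetP => A; rewrite !inE leqn0 mxrank_eq0 //.
(* At full rank the ball is the whole space and the exponent is exactly [n.+1 * m]. *)
have [rn'|rn'] := leqP n r.
  have -> : r = n by lia.
  rewrite (leq_trans (max_card _)) // card_mx addnK leq_pmull // expn_gt0 //.
apply: leq_trans (card_rank_ball_recl _ _) _; rewrite [(2 ^ n.+1)%N]expnS mul2n -addnn mulnDl.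
have qle a b : (a <= b)%N -> (q ^ a <= q ^ b)%N by move=> ab; rewrite leq_pexp2l.
apply: leq_add.
  apply: leq_trans (leq_mul (IH _ rn') (leqnn _)) _.
  by rewrite -mulnA -expnD leq_mul2l qle ?orbT //; nia.
apply: leq_trans (leq_mul (IH _ (ltnW rn')) (leqnn _)) _.
by rewrite -mulnA -expnD leq_mul2l qle ?orbT //; nia.
Qed.
End Balls.

(** * Bounds on the covering radius *)

Section Radius.
Variables (K : finFieldType) (n m : nat).
Local Notation V := 'M[K]_(n, m).
Local Notation q := #|K|.

Lemma rk_coversW (C : {vspace V}) (r s : nat) :
  (r <= s)%N -> rk_covers C r -> rk_covers C s.
Proof.
move=> rs /forallP cov; apply/forallP => x.
have /existsP[y /andP[yC rk]] := cov x.
by apply/existsP; exists y; rewrite yC (leq_trans rk).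
Qed.

Lemma rk_covering_radiusP (C : {vspace V}) (r : nat) :
  rk_covers C r -> (forall s, s < r -> ~~ rk_covers C s)%N ->
  rk_covering_radius C = r.
Proof.
move=> cr ncov; rewrite /rk_covering_radius; case: ex_minnP => s cs smin.
apply/eqP; rewrite eqn_leq smin // leqNgt; apply/negP => sr.
by have := ncov s sr; rewrite cs.
Qed.

(** Addition maps [C] times the ball of radius [r] onto the whole space. *)
Lemma rk_covers_card (C : {vspace V}) (r : nat) : rk_covers C r ->
  (q ^ (n * m) <= q ^ \dim C * #|rank_ball K m n r|)%N.
Proof.
move=> /forallP cov; rewrite -card_mx -card_vspace -cardX.
pose f (z : V * V) := z.1 + z.2.
apply: leq_trans (leq_imset_card f _); apply: eq_leq; apply/esym/eq_card => x.
have /existsP[y /andP[yC rk]] := cov x; rewrite [RHS]inE; apply/imsetP.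
by exists (y, x - y); rewrite ?inE /f /= ?yC // addrC subrK.
Qed.

(** Since [n * m - r * (m + n - r) = (n - r) * (m - r)], the size bound leaves a spare factor [q],
    which beats [2 ^ n]. *)
Lemma rk_covers_gt (C : {vspace V}) (r : nat) : (r <= n <= m)%N ->
  (\dim C < (n - r) * (m - r))%N -> (2 ^ n < q)%N -> ~~ rk_covers C r.
Proof.
move=> /andP[rn nm] dC hq; apply/negP => /rk_covers_card.
rewrite leqNgt => /negP; apply.
apply: leq_ltn_trans (leq_mul (leqnn _) (card_rank_ball _ _ rn)) _.
have q0 : (0 < q)%N by apply: leq_trans hq.
rewrite mulnCA -expnD.
apply: (@leq_trans (q * q ^ (\dim C + r * (m + n - r)))).
  by rewrite ltn_pmul2r // expn_gt0 q0.
by rewrite -expnS leq_pexp2l //; nia.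
Qed.

(** Written as an image so that its dimension follows from injectivity and the rank bound from
    factoring through [t] rows. *)
Definition top_rows_space (t : nat) : {vspace V} :=
  limg (linfun (mulmx (pid_mx t : 'M[K]_(n, t)) : 'M[K]_(t, m) -> V)).

Lemma dim_top_rows_space (t : nat) : (t <= n)%N ->
  \dim (top_rows_space t) = (t * m)%N.
Proof.
move=> tn; rewrite limg_dim_eq ?dimvf ?dim_matrix //.
apply/eqP; rewrite capfv; apply/lker0P => A B; rewrite !lfunE /=.
(* The transposed partial identity is a left inverse. *)
move=> /(congr1 (mulmx (pid_mx t : 'M[K]_(t, n)))).
by rewrite !mulmxA pid_mx_id // pid_mx_1 !mul1mx.
Qed.

Lemma rk_covers_top_rows (C : {vspace V}) (t : nat) :
  (C + top_rows_space t)%VS = fullv -> rk_covers C t.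
Proof.
move=> CU; apply/forallP => x; have : x \in (C + top_rows_space t)%VS.
  by rewrite CU memvf.
case/memv_addP => y yC [u /memv_imgP[A _ ->] ->].
apply/existsP; exists y; rewrite yC addrC addKr lfunE /=.
exact: leq_trans (mxrankM_maxr _ _) (rank_leq_row _).
Qed.
End Radius.

(** * Proportion of subspaces with the expected radius *)

Section Combination.
Variables (K : finFieldType) (n m k : nat).
Local Notation q := #|K|.

Lemma card_subspaces_of_dim_gt0 :
  (k <= n * m)%N -> (0 < #|subspaces_of_dim K n m k|)%N.
Proof.
move=> kN; apply/card_gt0P.
pose X := vbasis {: 'M[K]_(n, m)}.
exists <<take k X>>%VS; rewrite inE; apply/eqP.
have fX : free X by exact: basis_free (vbasisP _).
have : free (take k X) by move: fX; rewrite -{1}(cat_take_drop k X) => /catl_free.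
rewrite /free => /eqP ->.
by rewrite size_takel // size_tuple dimvf dim_matrix.
Qed.

(** At most a fraction [1 / (q - 1)] of the subspaces fail to span everything together with the top
    rows; all others have the expected radius. Denominators are cleared to stay in natural
    numbers. *)
Lemma card_subspaces_of_dim_radius : (0 < m)%N -> (n <= m)%N ->
  (k <= n * m)%N -> (k < (m - n + k %/ m + 1) * (k %/ m + 1))%N ->
  (2 ^ n < q)%N ->
  (#|subspaces_of_dim K n m k| * (q - 2)
    <= #|subspaces_of_dim_radius K n m k (n - k %/ m)| * (q - 1))%N.
Proof.
move=> m0 nm kN hk hq; set l := (k %/ m)%N in hk *; set S := subspaces_of_dim K n m k.
have ln : (l <= n)%N by rewrite -(mulnK n m0) leq_div2r.
pose U : {vspace 'M[K]_(n, m)} := top_rows_space K n m (n - l).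
pose B := [set C in S | (C + U)%VS != fullv].
have cB : (#|B| * (q - 1) <= #|S|)%N.
  apply: card_noncomplement; rewrite dim_top_rows_space ?leq_subr // mulnBl.
  by have := leq_divM k m; rewrite -/l; lia.
have SB : (#|S| <= #|B| + #|subspaces_of_dim_radius K n m k (n - l)|)%N.
  apply: leq_trans (leq_card_setU _ _); apply/subset_leq_card/fintype.subsetP => C CS.
  rewrite inE [C \in B]inE [C \in subspaces_of_dim_radius _ _ _ _ _]inE -/S CS /=.
  have [CU|//] := eqVneq (C + U)%VS fullv; apply/eqP.
  apply: rk_covering_radiusP; first exact: rk_covers_top_rows.
  (* Covering is monotone in the radius, so [r = n - l - 1] suffices; there [(n - r) * (m - r)] is
     the bound in [hk]. *)
  move=> s sl; have sl' : (s <= n - l - 1)%N by lia.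
  apply: contra (rk_coversW sl') _; apply: rk_covers_gt hq; first by lia.
  move: CS; rewrite inE => /eqP ->; apply: leq_trans hk _.
  by rewrite mulnC; apply: leq_mul; lia.
by move: cB SB; nia.
Qed.
End Combination.

(** * The limit over prime powers *)

Local Open Scope classical_set_scope.
Unset Implicit Arguments.

Theorem theorem8p5 (R : realType) (F : nat -> finFieldType)
    (hF : is_Fq_family F) (n m k : nat)
    (hn : (2 <= n)%N) (hnm : (n <= m)%N) (hk : (k <= n * m)%N)
    (hkm : (k < (m - n + k %/ m + 1) * (k %/ m + 1))%N) :
  (#|subspaces_of_dim_radius (F q) n m k (n - k %/ m)|%:R
     / #|subspaces_of_dim (F q) n m k|%:R : R) @[q --> prime_powers_oo]
  --> (1 : R).
Proof.
apply/(@cvgrPdist_le R R^o) => e e0.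
have [N hN] : exists N : nat, e^-1 < N%:R.
  by exists (Num.truncn e^-1).+1; exact: truncnS_gt.
(* [N.+2] makes [q - 2] exceed [1 / e]; [2 ^ n < q] is what the counting bound requires. *)
exists (maxn N.+2 (2 ^ n).+1) => // q /=; rewrite geq_max => /andP[qN qn] qpp.
have qE := hF q qpp.
have m0 : (0 < m)%N by lia.
have := card_subspaces_of_dim_radius (K := F q) m0 hnm hk hkm.
have := card_subspaces_of_dim_gt0 (F q) hk.
have : (#|subspaces_of_dim_radius (F q) n m k (n - k %/ m)|
    <= #|subspaces_of_dim (F q) n m k|)%N.
  by apply/subset_leq_card/fintype.subsetP => C; rewrite inE => /andP[].
rewrite qE; move: #|subspaces_of_dim _ _ _ _| #|subspaces_of_dim_radius _ _ _ _ _|.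
move=> s s' s's s0 /(_ qn) low.
have sR : 0 < s%:R :> R by rewrite ltr0n.
rewrite ger0_norm; last first.
  by rewrite subr_ge0 ler_pdivrMr // mul1r ler_nat.
rewrite lerBlDr -lerBlDl ler_pdivlMr //.
(* With [p = q - 2] the ratio is at least [p / (p + 1)], so its distance to 1 is at most
   [1 / (p + 1)], below [e]. *)
have [p qp] : exists p, q = p.+2 by exists (q - 2)%N; lia.
have lowR : s%:R * p%:R <= s'%:R * p.+1%:R :> R.
  by rewrite -!natrM ler_nat; move: low; rewrite qp; nia.
have ep : 1 <= e * p%:R.
  rewrite mulrC -ler_pdivrMr // div1r; apply: le_trans (ltW hN) _.
  by rewrite ler_nat; lia.
rewrite -natr1 in lowR.
have p0 : 0 <= p%:R :> R by rewrite ler0n.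
nra.
Qed.
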